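(* Let $\mathcal H$ be a separable real Hilbert space and $\mathcal J:\mathcal H\to\mathbb R$ a continuous linear function. Suppose $P$ is a closed, bounded, and strictly convex subset of $\mathcal H$, and that $P$ contains the zero vector in its relative interior. If $\mathcal J$ is not uniformly vanishing on $P$, then the optimal solution to the problem of finding $\dot k\in P$ with $$\mathcal J(\dot k)=\max_{\dot h\in P}\mathcal J(\dot h)$$ is unique.
   Context: The relative interior of a closed convex set $C$ is the interior of $C$ relative to the closed affine hull of $C$. A convex closed set $A\subseteq\mathcal H$ is strictly convex if for each pair of distinct points $x,y\in A$ and all $0<\gamma<1$, the point $\gamma x+(1-\gamma)y$ lies in the relative interior of $A$. *)

(* Defs.v *)
From HB Require Import structures.
From mathcomp Require Import all_boot all_order all_algebra.
From mathcomp Require Import all_classical all_reals all_analysis.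

Set Implicit Arguments.
Unset Strict Implicit.
Unset Printing Implicit Defensive.

Import Order.TTheory GRing.Theory Num.Theory.
Import numFieldNormedType.Exports.

Local Open Scope classical_set_scope.
Local Open Scope ring_scope.

Definition separable_space (T : topologicalType) : Prop :=
  exists2 D : set T, countable D & dense D.

(* The inner products on [H] that induce its given norm; [H] being complete for
   that norm, such an inner product makes [H] a real Hilbert space. *)
Definition induces_norm (R : realType) (H : normedModType R)
    (dotp : {dot H for @idfun R}) : Prop :=
  forall x : H, `|x| = Num.sqrt (dotp x x).

Section RelativeInterior.
Context {R : realType} {H : normedModType R}.

Definition affine_set (A : set H) : Prop :=
  forall (x y : H) (t : R), A x -> A y -> A (t *: x + (1 - t) *: y).

Definition closed_affine_hull (C : set H) : set H :=
  smallest [set A | closed A /\ affine_set A] C.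

(* [subspace A] carries the subspace topology at the points of [A] and the
   discrete topology elsewhere; as [C] is included in its hull, only the former
   matters here. *)
Definition relative_interior (C : set H) : set H :=
  @interior (subspace (closed_affine_hull C)) C.

Definition strictly_convex (A : set H) : Prop :=
  [/\ convex_set (M := H) A, closed A &
    forall (x y : H) (g : R), A x -> A y -> x != y -> 0 < g < 1 ->
      relative_interior A (g *: x + (1 - g) *: y)].

End RelativeInterior.

Definition maximizer_on (T : Type) (R : realType) (J : T -> R) (P : set T)
    (k : T) : Prop :=
  P k /\ forall h, P h -> J h <= J k.

(* Main.v *)
(* Existence: if the norm satisfies the parallelogram law, then near-maximizers of
   [J] on [P] of nearly least norm form a Cauchy filter, as their midpoints are
   again near-maximizers; its limit maximizes [J], so no weak compactness is
   needed.  Uniqueness: as [0] is relatively interior and [J] does not vanish on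
   [P], the maximum is positive.  The midpoint [m] of two distinct maximizers is
   relatively interior, so [P] contains [(1 + t) m] for some [t > 0], where [J]
   exceeds its maximum. *)

Require Import Defs.
From HB Require Import structures.
From mathcomp Require Import all_boot all_order all_algebra.
From mathcomp Require Import all_classical all_reals all_analysis.
From mathcomp Require Import ring lra.

Set Implicit Arguments.
Unset Strict Implicit.
Unset Printing Implicit Defensive.

Import Order.TTheory GRing.Theory Num.Theory.
Import numFieldNormedType.Exports.

Local Open Scope classical_set_scope.
Local Open Scope ring_scope.

(** The usual identity, with the sum written through the midpoint, so that a lower bound on the norm
    of the midpoint bounds the distance. *)
Definition parallelogram_law (R : realType) (H : normedModType R) : Prop :=
  forall x y : H, `|x - y| ^+ 2 =
    2 * `|x| ^+ 2 + 2 * `|y| ^+ 2 - 4 * `|2^-1 *: (x + y)| ^+ 2.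

Lemma induced_norm_parallelogram (R : realType) (H : normedModType R)
    (dotp : {dot H for @idfun R}) : induces_norm dotp -> parallelogram_law H.
Proof.
move=> dotp_norm x y.
have normE z : `|z| ^+ 2 = dotp z z.
  rewrite dotp_norm sqr_sqrtr//.
  have [->|z0] := eqVneq z 0; first by rewrite linear0r.
  exact/ltW/neq0_dnorm_gt0.
rewrite normrZ exprMn !normE ger0_norm ?invr_ge0//.
rewrite (linearBl dotp) !(linearBr dotp) (linearDl dotp) !(linearDr dotp) /=; by field.
Qed.

(** The midpoint of two points of [C e] stays in [C e], so its norm cannot fall far below the least
    one; the parallelogram law then forces points of nearly least norm together. *)
Lemma nested_closed_midpoint_convex_meet (R : realType)
    (H : completeNormedModType R) (C : R -> set H) (B : R) :
  parallelogram_law H ->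
  (forall e f, e <= f -> C e `<=` C f) ->
  (forall e, 0 < e -> closed (C e)) ->
  (forall e, 0 < e -> C e !=set0) ->
  (forall e x y, C e x -> C e y -> C e (2^-1 *: (x + y))) ->
  (forall e x, C e x -> `|x| <= B) ->
  exists x, forall e, 0 < e -> C e x.
Proof.
move=> parallelogram C_mono C_closed C_nonempty C_mid C_bounded.
(* [d] is the limit, as [e] tends to [0], of the least squared norm on [C e]. *)
pose S := [set s : R | exists2 e, 0 < e & forall x, C e x -> s <= `|x| ^+ 2].
have S_sup : has_sup S.
  split; first by exists 0, 1 => // x _; rewrite sqr_ge0.
  exists (B ^+ 2) => s [e e0 se].
  have [x Cx] := C_nonempty e e0; apply: (le_trans (se x Cx)).
  by rewrite lerXn2r ?nnegrE ?(le_trans _ (C_bounded e x Cx)) ?(C_bounded e).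
pose d := sup S.
pose A e := [set x : H | C e x /\ `|x| ^+ 2 < d + e].
have A_mono e f : e <= f -> A e `<=` A f.
  by move=> ef x [Cx xd]; split; [exact: C_mono Cx|lra].
have A_nonempty e : 0 < e -> A e !=set0.
  move=> e0; apply: contrapT => A0.
  (* If [A e] is empty, [d + e] bounds the squared norm on [C e] from below. *)
  suff /(sup_upper_bound S_sup) : S (d + e) by rewrite -/d; lra.
  exists e => // x Cx; rewrite leNgt; apply/negP => xd.
  by apply: A0; exists x.
pose F := filter_from [set e : R | 0 < e] A.
have F_filter : Filter F.
  apply: filter_from_filter; first by exists 1 => /=.
  move=> e f /= e0 f0; exists (Num.min e f); first by rewrite /= lt_min e0.
  by move=> x Ax; split; apply: A_mono Ax; rewrite ge_min lexx ?orbT.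
have F_proper : ProperFilter F by apply: filter_from_proper.
have F_cauchy : cauchy F.
  apply: cauchy_exP => eps eps0; pose eta := eps ^+ 2 / 16.
  have eta0 : 0 < eta by rewrite divr_gt0 ?exprn_gt0.
  have [s [f f0 sf] ds] := sup_adherent eta0 S_sup.
  (* As [e <= f], midpoints of points of [A e] lie in [C f], where the squared norm is at least
     [s > d - eta]. As [e <= eta], this gives [|x - y| ^+ 2 < 4 * (d + eta) - 4 * (d - eta)], which
     is [8 * eta], half of [eps ^+ 2]. *)
  pose e := Num.min f eta.
  have e0 : 0 < e by rewrite lt_min f0.
  have ef : e <= f by rewrite ge_min lexx.
  have e_eta : e <= eta by rewrite ge_min lexx orbT.
  have [x Ax] := A_nonempty e e0; exists x, e => // y Ay.
  rewrite -ball_normE /=.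
  rewrite -(@ltr_pXn2r _ 2) ?nnegrE ?(ltW eps0)// parallelogram.
  have := sf _ (C_mono _ _ ef _ (C_mid _ _ _ Ax.1 Ay.1)).
  have := Ax.2; have := Ay.2; move: ds; rewrite -/d.
  have -> : eps ^+ 2 = 16 * eta by rewrite /eta; field.
  by move: (`|x| ^+ 2) (`|y| ^+ 2) (`|_| ^+ 2) => a b c; lra.
exists (lim F) => e e0.
apply: (@closed_cvg _ _ F F_proper id _ (C_closed e e0)).
  by exists e => // x [].
exact: cauchy_cvg F_cauchy.
Qed.

Lemma linear_has_maximizer (R : realType) (H : completeNormedModType R)
    (J : {linear H -> R^o}) (P : set H) :
  parallelogram_law H ->
  continuous J -> closed P -> bounded_set P -> P !=set0 ->
  (forall x y, P x -> P y -> P (2^-1 *: (x + y))) ->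
  exists k, maximizer_on J P k.
Proof.
move=> parallelogram J_cont P_closed P_bounded [p Pp] P_mid.
have [B [_ PB]] := P_bounded.
(* [bounded_set] bounds the norm only by numbers strictly above [B]. *)
have {}PB x : P x -> `|x| <= B + 1 by apply: PB; lra.
have [r r0 Jr] : exists2 r : R, 0 < r & forall x, `|J x| <= r * `|x|.
  move/linear_bounded_continuous/linear_boundedP : J_cont => [r0 [_ Jr0]].
  by exists (Num.max 1 (r0 + 1)) => [|x]; [|apply: Jr0]; rewrite lt_max; lra.
have JP_sup : has_sup (J @` P).
  split; first by exists (J p), p.
  exists (r * (B + 1)) => _ [x Px <-].
  apply: (le_trans (ler_norm _)); apply: (le_trans (Jr x)).
  by rewrite ler_pM2l// PB.
pose M : R := sup (J @` P).
(* A point common to all [C e] with [e > 0] attains the supremum [M]. *)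
pose C e := P `&` [set x | M - e <= J x].
have [|||||k Ck] :=
  @nested_closed_midpoint_convex_meet R H C (B + 1) parallelogram.
- by move=> e f ef x [Px Jx]; split=> //=; apply: le_trans Jx; lra.
- move=> e e0; apply: closedI => //.
  by apply: (@preimage_closed _ _ J [set y | M - e <= y]);
    [move=> ? _; exact: J_cont|exact: closed_ge].
- by move=> e e0; have [_ [x Px <-] /ltW Jx] := sup_adherent e0 JP_sup; exists x.
- move=> e x y [Px Jx] [Py Jy]; split; first exact: P_mid.
  by rewrite /= linearZ linearD /= /GRing.scale /=; move: Jx Jy => /=; lra.
- by move=> e x [/PB].
exists k; split; first by have [] := Ck 1 ltr01.
move=> h Ph; apply: (@le_trans _ _ M).
  by apply: (sup_upper_bound JP_sup); exists h.
by apply/ler_addgt0Pr => e /Ck[_ /=]; lra.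
Qed.

Lemma relative_interior_sub (R : realType) (H : normedModType R) (P : set H) :
  relative_interior P `<=` P.
Proof. exact: (@interior_subset (subspace (closed_affine_hull P)) P). Qed.

(** The line through [x] and [y] stays in the closed affine hull, where [P] is a neighbourhood of
    [x]; so the segment from [y] can be prolonged slightly past [x]. *)
Lemma relative_interior_extend (R : realType) (H : normedModType R)
    (P : set H) (x y : H) : relative_interior P x -> P y ->
  exists2 t : R, 0 < t & P ((1 + t) *: x + (1 - (1 + t)) *: y).
Proof.
move=> Px_int Py; have Px := relative_interior_sub Px_int.
pose L := closed_affine_hull P.
have PL : P `<=` L by exact: sub_smallest.
have L_affine : affine_set L.
  by move=> a b t La Lb A A_PL; apply: A_PL.1.2; [apply: La|apply: Lb].
have Px_near : within L (nbhs x) P by rewrite nbhs_subspace_in//; exact: PL.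
pose g (t : R) : H := (1 + t) *: x + (1 - (1 + t)) *: y.
have g_cvg : g t @[t --> (0 : R)] --> x.
  have -> : x = g 0 by rewrite /g addr0 subrr scale1r scale0r addr0.
  have g_cont : continuous g.
    move=> t; apply: cvgD; apply: cvgZr_tmp; last apply: cvgB;
      by [exact: cvg_cst|apply: cvgD; [exact: cvg_cst|exact: cvg_id]].
  exact: g_cont.
have [e /= e0 eP] := (nbhs_ballP _ _).1 (g_cvg _ Px_near).
exists (e / 2); first by rewrite divr_gt0.
apply: eP; last by apply: L_affine; exact: PL.
by rewrite -ball_normE /= sub0r normrN ger0_norm; lra.
Qed.

Theorem proposition4p3 (R : realType) (H : completeNormedModType R)
    (dotp : {dot H for @idfun R}) (dotp_norm : induces_norm dotp)
    (H_separable : separable_space H)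
    (J : {linear H -> R^o}) (J_continuous : continuous J)
    (P : set H) (P_closed : closed P) (P_bounded : bounded_set P)
    (P_strictly_convex : strictly_convex P)
    (P_relint0 : relative_interior P 0)
    (J_nonvanishing : ~ (forall h : H, P h -> J h = 0)) :
  exists! k : H, maximizer_on J P k.
Proof.
have [_ _ P_strict] := P_strictly_convex.
have P0 := relative_interior_sub P_relint0.
have half01 : 0 < (2^-1 : R) < 1 by lra.
have midE (x y : H) : 2^-1 *: (x + y) = 2^-1 *: x + (1 - 2^-1) *: y.
  by rewrite scalerDr; congr (_ + _ *: _); lra.
have P_mid x y : P x -> P y -> P (2^-1 *: (x + y)).
  move=> Px Py; rewrite midE; have [<-|xy] := eqVneq x y.
    by rewrite -scalerDl addrC subrK scale1r.
  exact: (relative_interior_sub (P_strict _ _ _ Px Py xy half01)).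
have [k [Pk k_max]] := linear_has_maximizer
  (induced_norm_parallelogram dotp_norm) J_continuous
  P_closed P_bounded (ex_intro _ 0 P0) P_mid.
have Jk_gt0 : 0 < J k.
  rewrite ltNge; apply/negP => Jk; apply: J_nonvanishing => h Ph.
  apply/eqP; rewrite eq_le (le_trans (k_max _ Ph))//=.
  (* Prolonging from [h] past [0] puts [- t *: h] in [P]; if [J h < 0], its value is positive,
     against [J k <= 0]. *)
  have [t t0 /k_max] := relative_interior_extend P_relint0 Ph.
  rewrite linearD !linearZ linear0 /= /GRing.scale /= => Jt.
  by rewrite leNgt; apply/negP => Jh; nra.
exists k; split=> // l [Pl l_max]; apply/eqP/negPn/negP => kl.
have Jkl : J l = J k by apply/eqP; rewrite eq_le k_max// l_max.
have [t t0 /k_max] := relative_interior_extend (P_strict _ _ _ Pk Pl kl half01) P0.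
rewrite !(linearD, linearZ, linear0) /= /GRing.scale /= Jkl.
by nra.
Qed.
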